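(* For all integers $k \geq 1$, $SP(2k+1,k) \leq 2k$.
   Context: A $k$-partition of a finite set $X$ is a collection of exactly $k$ pairwise disjoint non-empty subsets of $X$ (called classes) whose union is $X$. A Sperner $k$-partition system on $X$ is a set $\mathcal{P}$ of $k$-partitions of $X$ such that for any two distinct partitions $P, Q \in \mathcal{P}$, no class of $P$ is a subset of (in particular, equal to) a class of $Q$. $SP(n,k)$ denotes the maximum number of partitions in a Sperner $k$-partition system on a set of $n$ elements. *)

(* Defs.v *)
From mathcomp Require Import all_boot.
Set Implicit Arguments.
Unset Strict Implicit.
Unset Printing Implicit Defensive.

Definition kpartition (T : finType) (k : nat) (P : {set {set T}}) : bool :=
  partition P [set: T] && (#|P| == k).

Definition sperner_system (T : finType) (k : nat)
    (S : {set {set {set T}}}) : bool :=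
  [forall P in S, kpartition k P] &&
  [forall P in S, forall Q in S, (P != Q) ==>
     [forall A in P, forall B in Q, ~~ (A \subset B)]].

(* The ground set is 'I_n. The empty system is Sperner, so the maximum ranges
   over a non-empty family and is attained. *)
Definition SP (n k : nat) : nat :=
  \max_(S : {set {set {set 'I_n}}} | sperner_system k S) #|S|.

(* Main.v *)
Require Import Defs.
From mathcomp Require Import all_boot.

(** Suppose that a Sperner system consists of 2k+1 partitions of a set of 2k+1
    points. A singleton class of one partition would be contained in a class of
    every other one, so all classes have at least two points, and counting
    points shows that each partition consists of one triple and k-1 pairs
    ([partition_pairs_triple]).

    Fix a point v and remove it from the classes that contain it. The resulting
    2k+1 sets, the link of v, form an antichain of singletons and pairs in a set
    of 2k points. If t of them are pairs, these pairs avoid the 2k+1-t points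
    that carry singletons, so they live on t-1 points and t <= 'C(t-1, 2), with
    t > 0; hence t >= 5 ([antichain12_pairs_ge5]). So every point lies in the
    triples of at least five of the partitions. This contradicts the fact that
    the 2k+1 triples, spread over 2k+1 points, cover a point three times on
    average. *)

Set Implicit Arguments.
Unset Strict Implicit.
Unset Printing Implicit Defensive.

(** * Antichains of singletons and pairs *)

Section Antichain12.

Variables (T : finType) (U : {set T}) (F : {set {set T}}).
Hypothesis F_sub : {in F, forall A : {set T}, A \subset U}.
Hypothesis F_card : {in F, forall A : {set T}, (#|A| == 1) || (#|A| == 2)}.
Hypothesis F_antichain : {in F &, forall A B : {set T}, A \subset B -> A = B}.

(** A pair of the antichain contains no point whose singleton belongs to it, so
    all the pairs are drawn from the remaining points of [U]. *)
Lemma antichain12_pairs_le_bin :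
  #|[set A in F | #|A| == 2]| <= 'C(#|U| - #|[set A in F | #|A| == 1]|, 2).
Proof.
pose N := [set w | [set w] \in F].
have NU : N \subset U.
  by apply/subsetP=> w; rewrite inE => /F_sub; rewrite sub1set.
have -> : #|[set A in F | #|A| == 1]| = #|N|.
  rewrite -(card_imset N (@set1_inj T)); apply: eq_card => A; rewrite inE.
  apply/andP/imsetP => [[AF /cards1P[w def_A]] | [w wN ->]].
    by exists w; rewrite // inE -def_A.
  by rewrite cards1 eqxx; move: wN; rewrite inE.
rewrite -[#|U| - _](_ : #|U :\: N| = _); last first.
  by rewrite cardsD (setIidPr NU).
rewrite -cards_draws; apply/subset_leq_card/subsetP=> A; rewrite !inE.
move=> /andP[AF A2]; rewrite A2 andbT; apply/subsetP=> w wA.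
rewrite !inE (subsetP (F_sub AF)) // andbT; apply/negP=> wF.
have def_A : [set w] = A by apply: F_antichain; rewrite ?sub1set.
by rewrite -def_A cards1 in A2.
Qed.

Lemma card_antichain12 :
  #|[set A in F | #|A| == 1]| + #|[set A in F | #|A| == 2]| = #|F|.
Proof.
rewrite -(cardsID [set A : {set T} | #|A| == 1] F).
congr (_ + _); apply: eq_card => A; rewrite !inE //.
case: (boolP (A \in F)) => [/F_card | _]; last by rewrite andbF.
by case: eqP => [-> | _].
Qed.

(** With [t] pairs, the antichain has [#|U|.+1 - t] singletons, which leaves
    [t.-1] points for the pairs; [t <= 'C(t.-1, 2)] fails for [t] in 1..4, and
    [t] is positive because there are at most [#|U|] singletons. *)
Lemma antichain12_pairs_ge5 :
  #|F| = #|U|.+1 -> 5 <= #|[set A in F | #|A| == 2]|.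
Proof.
move=> cardF; move: card_antichain12 antichain12_pairs_le_bin; rewrite cardF.
set s := #|_|; set t := #|_| => def_t.
have s_le : s <= #|U|.
  have -> : s = #|[set A : {set T} | A \subset U & #|A| == 1] :&: F|.
    apply: eq_card => A; rewrite !inE; case: (boolP (A \in F)) => AF.
      by rewrite F_sub // andbT.
    by rewrite andbF.
  by rewrite (leq_trans (subset_leq_card (subsetIl _ _))) // cards_draws bin1.
have -> : #|U| - s = t.-1.
  by rewrite -[t](addKn s) def_t subSn.
have t_gt0 : 0 < t by rewrite -(addKn s t) def_t subn_gt0 ltnS.
by case: t t_gt0 {def_t} => [|[|[|[|[|t]]]]].
Qed.

End Antichain12.

(** * Partitions into pairs and a triple *)

(** The sizes exceed 2 by a total of [#|T| - 2 * #|P| = 1], so exactly one class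
    carries this excess. *)
Lemma partition_pairs_triple (T : finType) (P : {set {set T}}) :
    partition P [set: T] -> #|T| = 2 * #|P| + 1 ->
    {in P, forall A : {set T}, 1 < #|A|} ->
  exists A, [/\ A \in P, #|A| = 3
              & {in P, forall B : {set T}, B != A -> #|B| = 2}].
Proof.
move=> partP cardT gt1.
have excess1 : \sum_(A in P) (#|A| - 2) == 1.
  rewrite -(eqn_add2l (2 * #|P|)) -cardT -cardsT (card_partition partP).
  rewrite mulnC -sum_nat_const -big_split /=; apply/eqP/eq_bigr=> A /gt1 A_gt1.
  by rewrite subnKC.
case/sum_nat_eq1: excess1 => A [AP A3 rest]; exists A; split=> //.
  by rewrite -(subnKC (gt1 _ AP)) A3.
by move=> B BP neqBA; rewrite -(subnKC (gt1 _ BP)) rest.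
Qed.

(** * Sperner systems on an odd number of points *)

Section OddSperner.

Variables (T : finType) (k : nat) (S : {set {set {set T}}}).
Hypothesis S_sperner : sperner_system k S.

Lemma sperner_partition P : P \in S -> partition P [set: T].
Proof. by case/andP: S_sperner => /forall_inP H _ /H/andP[]. Qed.

Lemma sperner_card P : P \in S -> #|P| = k.
Proof. by case/andP: S_sperner => /forall_inP H _ /H/andP[_ /eqP]. Qed.

Lemma sperner_class_inj P Q (A B : {set T}) :
  P \in S -> Q \in S -> A \in P -> B \in Q -> A \subset B -> P = Q.
Proof.
case/andP: S_sperner => _ /forall_inP H PS QS AP BQ; apply: contraTeq => neqPQ.
by move/forall_inP/(_ Q QS)/implyP/(_ neqPQ): (H P PS)
  => /forall_inP/(_ A AP)/forall_inP/(_ B BQ).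
Qed.

Lemma sperner_pblock P v : P \in S -> pblock P v \in P /\ v \in pblock P v.
Proof.
move=> /sperner_partition/and3P[/eqP covP _ _].
have v_cov : v \in cover P by rewrite covP.
by rewrite pblock_mem // mem_pblock.
Qed.

(** The point of a singleton class lies in some class of any other partition,
    which would then contain that singleton. *)
Lemma sperner_class_gt1 P (A : {set T}) :
  1 < #|S| -> P \in S -> A \in P -> 1 < #|A|.
Proof.
move=> S_gt1 PS AP; rewrite ltnNge; apply/negP=> A_le1.
have A_n0 : A != set0.
  by apply: contraTneq AP => ->; case/and3P: (sperner_partition PS).
have /cards1P[x def_A] : #|A| == 1 by rewrite eqn_leq A_le1 card_gt0.
have [Q] : exists Q, Q \in S :\ P.
  by apply/set0Pn; move: S_gt1; rewrite (cardsD1 P) PS ltnS card_gt0.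
rewrite !inE => /andP[neqQP QS]; case/eqP: neqQP.
have [BQ xB] := sperner_pblock x QS.
by rewrite (@sperner_class_inj P Q A (pblock Q x)) // def_A sub1set.
Qed.

Hypothesis k_gt0 : 0 < k.
Hypothesis cardT : #|T| = 2 * k + 1.
Hypothesis cardS : #|S| = 2 * k + 1.

Lemma sperner_triple P : P \in S ->
  exists A, [/\ A \in P, #|A| = 3
              & {in P, forall B : {set T}, B != A -> #|B| = 2}].
Proof.
move=> PS; apply: partition_pairs_triple; rewrite ?sperner_partition //.
  by rewrite sperner_card.
move=> A; apply: sperner_class_gt1 PS.
by rewrite cardS addn1 ltnS muln_gt0.
Qed.

(** The classes through [v], with [v] removed, are an antichain of [#|T|]
    singletons and pairs in the other [#|T| - 1] points. *)
Lemma sperner_triples_at v : 5 <= #|[set P in S | #|pblock P v| == 3]|.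
Proof.
pose link P := pblock P v :\ v.
have linkK P : P \in S -> v |: link P = pblock P v.
  by move=> /(sperner_pblock v)[_ /setD1K].
have card_link P : P \in S -> #|pblock P v| = #|link P|.+1.
  by move=> /(sperner_pblock v)[_ vP]; rewrite (cardsD1 v) vP.
have link_sub P Q : P \in S -> Q \in S -> link P \subset link Q -> P = Q.
  move=> PS QS /(setUS [set v]); rewrite !linkK //.
    by apply: sperner_class_inj => //; apply: (proj1 (sperner_pblock v _)).
have link_inj : {in S &, injective link}.
  by move=> P Q PS QS eqPQ; apply: link_sub; rewrite // eqPQ.
have -> : #|[set P in S | #|pblock P v| == 3]|
          = #|[set A in link @: S | #|A| == 2]|.
  rewrite -(card_in_imset (f := link)); last first.
    by move=> P Q /setIdP[PS _] /setIdP[QS _]; apply: link_inj.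
  apply: eq_card => A; rewrite inE; apply/imsetP/andP.
    by case=> P /setIdP[PS]; rewrite card_link // eqSS => P2 ->; rewrite imset_f.
  by case=> /imsetP[P PS ->] P2; exists P; rewrite // inE PS card_link.
apply: (@antichain12_pairs_ge5 _ [set~ v]).
- by move=> _ /imsetP[P _ ->]; rewrite /link setDE subsetIr.
- move=> _ /imsetP[P PS ->]; have [A [_ A3 pairs]] := sperner_triple PS.
  rewrite -!(eqSS #|_|) -card_link //.
  have [-> | neqA] := eqVneq (pblock P v) A; first by rewrite A3.
  by rewrite pairs //; case: (sperner_pblock v PS).
- move=> _ _ /imsetP[P PS ->] /imsetP[Q QS ->] sPQ.
  by rewrite (link_sub P Q).
- by rewrite card_in_imset // cardsC1 cardT cardS addn1.
Qed.

Lemma card_triple_points P : P \in S -> #|[set v | #|pblock P v| == 3]| = 3.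
Proof.
move=> PS; have [A [AP A3 pairs]] := sperner_triple PS.
have /and3P[_ trivP _] := sperner_partition PS.
rewrite -[RHS]A3; apply: eq_card => v; rewrite inE.
have [BP vB] := sperner_pblock v PS.
apply/idP/idP => [v3 | vA]; last by rewrite (def_pblock trivP AP vA) A3.
case: (eqVneq (pblock P v) A) => [<- // | neqA].
by rewrite pairs in v3.
Qed.

(** Double counting of the pairs of a point and a triple that contains it. *)
Lemma no_sperner_odd : False.
Proof.
have : \sum_(v : T) 5 <= \sum_(v : T) #|[set P in S | #|pblock P v| == 3]|.
  by apply: leq_sum => v _; apply: sperner_triples_at.
have -> : \sum_(v : T) #|[set P in S | #|pblock P v| == 3]| = \sum_(P in S) 3.
  under eq_bigr => v _ do rewrite -sum1dep_card.
  rewrite (exchange_big_dep (fun P => P \in S)) /= => [|v P _ /andP[] //].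
  apply: eq_bigr => P PS; rewrite -[RHS](card_triple_points PS) -sum1dep_card.
  by apply: eq_bigl => v; rewrite PS.
by rewrite !sum_nat_const [#|_|]cardT cardS leq_mul2l addn1.
Qed.

End OddSperner.

(** Together with the existence of subsets of each smaller size, this reduces a
    system of more than [2 * k] partitions to one of exactly [2 * k + 1]. *)
Lemma sperner_systemS (T : finType) k (S S' : {set {set {set T}}}) :
  S' \subset S -> sperner_system k S -> sperner_system k S'.
Proof.
move=> /subsetP sS'S /andP[/forall_inP partS /forall_inP spS].
apply/andP; split; apply/forall_inP=> P /sS'S PS; first exact: partS.
by apply/forall_inP=> Q /sS'S; apply/forall_inP: Q; apply: spS.
Qed.

Theorem theorem3p1 (k : nat) (hk : 1 <= k) : SP (2 * k + 1) k <= 2 * k.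
Proof.
apply/bigmax_leqP => S spS; rewrite leqNgt; apply/negP=> S_gt.
have [S'] : exists S', S' \in [set S' : {set {set {set 'I_(2 * k + 1)}}}
                                | S' \subset S & #|S'| == 2 * k + 1].
  by apply/set0Pn; rewrite -card_gt0 cards_draws bin_gt0 (leq_trans _ S_gt) ?addn1.
rewrite inE => /andP[sS'S /eqP cardS'].
by apply: (no_sperner_odd (sperner_systemS sS'S spS)); rewrite ?card_ord.
Qed.
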